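(* Let $\mathcal{H}_K$ be a reproducing kernel Hilbert space of real-valued functions contained in $L^2(\mathbb{R})$, with positive definite kernel $K:\mathbb{R}^2\to\mathbb{R}$ and norm $\|\cdot\|_K$. Assume that $K$ is bounded and continuous on $\mathbb{R}^2$ and that there exists a constant $C_1$ such that $|h(x)-h(y)|\le C_1\|h\|_K|x-y|$ for any $h\in\mathcal{H}_K$ and all $x,y\in\mathbb{R}$. Let $n>2$, $\lambda>0$, and let $(x_i,y_i)\in[0,1]\times\mathbb{R}$, $i=1,\dots,n$, be such that the $n$ points $ty_i+(1-t)x_i$, $i=1,\dots,n$, are distinct in $\mathbb{R}$ for any $t\in[0,1]$. Then the problem of minimizing over $v\in\mathcal{X}$ the energy $$E_\lambda(v)=\int_0^1\frac1n\sum_{i=1}^n\big(y_i-x_i-v_t(ty_i+(1-t)x_i)\big)^2dt+\lambda\int_0^1\|h_t\|_K^2\,dt,$$ where $v_t(x)=a_1^t+a_2^tx+h_t(x)$ with $a_1^t,a_2^t\in\mathbb{R}$, $h_t\in\mathcal{H}_K$, has a unique solution $v^{n,\lambda}\in\mathcal{X}$ such that at each time $t\in[0,1]$, $v_t^{n,\lambda}$ is the solution of the following unconstrained smoothing problem: find $v_t\in\tilde{\mathcal{H}}$ which minimizes $$E_\lambda^t(v_t)=\frac1n\sum_{i=1}^n\big(y_i-x_i-v_t(ty_i+(1-t)x_i)\big)^2+\lambda\|h_t\|_K^2,$$ where $v_t(x)=a_1^t+a_2^tx+h_t(x)$. Moreover $v^{n,\lambda}\in\mathcal{X}^2$, and $f_{n,\lambda}^c$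 is a monotone function on $[0,1]$, where $f^c_{n,\lambda}(x)=\phi_1(x)$ and $\phi_t$ is the solution of $\frac{d\phi_t}{dt}=v_t^{n,\lambda}(\phi_t)$ with initial condition the identity on $[0,1]$, i.e. $f_{n,\lambda}^c(x)=x+\int_0^1v_t^{n,\lambda}(\phi_t(x))\,dt$.
   Context: $\tilde{\mathcal{H}}=\mathrm{Span}\{1,x\}+\mathcal{H}_K$ is the space of functions $\tilde h:\mathbb{R}\to\mathbb{R}$ of the form $\tilde h(x)=a_1+a_2x+h(x)$ with $a_1,a_2\in\mathbb{R}$, $h\in\mathcal{H}_K$, with norm $\|\tilde h\|=\max(|a_1|,|a_2|)+\|h\|_K$ (a Banach space). $\mathcal{X}$ is the set of all time-dependent vector fields $v=(v_t)_{t\in[0,1]}$, $v_t\in\tilde{\mathcal{H}}$ (measurable in $t$); $\mathcal{X}^2$ is the subset of those with $\int_0^1\|v_t\|^2dt<+\infty$. Elements $v$ are identified pointwise in $t$ as described in the claim (the minimizer is the one solving the smoothing problem at each $t$). A solution of $\frac{d\phi_t}{dt}=v_t(\phi_t)$ with initial condition the identity is a family such that for all $x\in[0,1]$, $t\mapsto\phi_t(x)$ is continuous from $[0,1]$ to $\mathbb{R}$, $\phi_0(x)=x$, and $\phi_t(x)=x+\int_0^tv_s(\phi_s(x))\,ds$ for all $t\in[0,1]$. In the paper, monotone refers to increasing functions. *)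

(* Defs.v *)
From mathcomp Require Import all_boot all_order all_algebra.
From mathcomp Require Import all_classical all_reals all_analysis.

Set Implicit Arguments.
Unset Strict Implicit.
Unset Printing Implicit Defensive.

Import Order.TTheory GRing.Theory Num.Theory numFieldNormedType.Exports.

Local Open Scope classical_set_scope.
Local Open Scope ring_scope.

Definition positive_definite_kernel (R : realType) (K : R -> R -> R) : Prop :=
  (forall x y, K x y = K y x) /\
  (forall (m : nat) (s c : 'I_m -> R),
     0 <= \sum_(i < m) \sum_(j < m) c i * c j * K (s i) (s j)).

(* A Hilbert space whose elements are, through the injective linear map
   [rkhs_fun], real functions on the line (defined pointwise, not up to null
   sets). The completeness and the norm are those of [rkhs_sort]; [rkhs_dot]
   is an inner product inducing this norm. *)
Record rkhs (R : realType) (K : R -> R -> R) := RKHS {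
  rkhs_sort :> completeNormedModType R ;
  rkhs_fun : {linear rkhs_sort -> (R -> R^o)} ;
  rkhs_fun_inj : injective rkhs_fun ;
  rkhs_dot : {dot rkhs_sort for idfun} ;
  rkhs_dot_norm : forall h : rkhs_sort, rkhs_dot h h = `|h| ^+ 2 ;
  rkhs_section : R -> rkhs_sort ;
  rkhs_sectionE : forall x y : R, rkhs_fun (rkhs_section x) y = K x y ;
  rkhs_reproducing : forall (h : rkhs_sort) (x : R),
    rkhs_dot h (rkhs_section x) = rkhs_fun h x }.

Section AffineExtension.
Context (R : realType) (K : R -> R -> R) (H : rkhs K).

(* [p] stands for ((a1, a2), h). *)
Definition affine_plus (p : R * R * H) : R -> R :=
  fun x => p.1.1 + p.1.2 * x + rkhs_fun H p.2 x.

Definition Htilde : set (R -> R) := range affine_plus.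

(* A function in [Htilde] has exactly one decomposition when the functions of
   [H] are square integrable, because 0 is then the only affine function
   among them. Outside [Htilde] the value is the junk value 0. *)
Definition decomp (f : R -> R) : R * R * H :=
  xget 0 [set p | affine_plus p = f].

Definition affine_cst (f : R -> R) : R := (decomp f).1.1.
Definition affine_slope (f : R -> R) : R := (decomp f).1.2.
Definition rkhs_part (f : R -> R) : H := (decomp f).2.

Definition Htilde_norm (f : R -> R) : R :=
  Num.max `|affine_cst f| `|affine_slope f| + `|rkhs_part f|.

Definition Htilde_open (U : set (R -> R)) : Prop :=
  U `<=` Htilde /\
  forall f, U f -> exists2 e : R, 0 < e &
    forall g, Htilde g -> Htilde_norm (g \- f) < e -> U g.

(* Time-dependent vector fields, Borel measurable in time for the norm
   topology of [Htilde]; the values at times outside [0, 1] are irrelevant. *)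
Definition vector_fields : set (R -> R -> R) :=
  [set v | (forall t : R, t \in `[0, 1] -> Htilde (v t)) /\
           (forall U, Htilde_open U ->
              measurable ([set t : R | t \in `[0, 1] /\ U (v t)]
                            : set (measurableTypeR R)))].

Definition vector_fields2 : set (R -> R -> R) :=
  [set v | vector_fields v /\
     (\int[lebesgue_measure]_(t in `[0%R, 1%R])
        ((Htilde_norm (v t)) ^+ 2)%:E < +oo)%E].

Section Energy.
Context (n : nat) (x y : 'I_n -> R) (lambda : R).

Definition path_point (t : R) (i : 'I_n) : R := t * y i + (1 - t) * x i.

Definition residual (t : R) (f : R -> R) : R :=
  n%:R^-1 * \sum_(i < n) (y i - x i - f (path_point t i)) ^+ 2.

Definition energy_at (t : R) (f : R -> R) : R :=
  residual t f + lambda * `|rkhs_part f| ^+ 2.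

Definition energy (v : R -> R -> R) : \bar R :=
  (\int[lebesgue_measure]_(t in `[0%R, 1%R]) (residual t (v t))%:E +
   lambda%:E *
   \int[lebesgue_measure]_(t in `[0%R, 1%R]) (`|rkhs_part (v t)| ^+ 2)%:E)%E.

End Energy.

End AffineExtension.

Definition minimizes (T : Type) (d : Order.disp_t) (P : porderType d)
    (S : set T) (E : T -> P) (v : T) : Prop :=
  S v /\ forall w, S w -> (E v <= E w)%O.

(* [phi t x] is the position at time t of the trajectory issued from x. The
   integrability clause makes the integral equation meaningful, since
   [Rintegral] is total. *)
Definition flow_from_identity (R : realType) (v phi : R -> R -> R) : Prop :=
  forall x : R, x \in `[0, 1] ->
    [/\ {within `[0, 1], continuous (fun t => phi t x)},
        phi 0 x = x,
        lebesgue_measure.-integrable `[0, 1]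
          (fun s => (v s (phi s x))%:E) &
        forall t : R, t \in `[0, 1] ->
          phi t x = x + \int[lebesgue_measure]_(s in `[0, t]) v s (phi s x)].

(* Main.v *)
(* The problem decouples in time. At a fixed time the energy is a quadratic
   function of the coordinates ((a1, a2), h), and its minimizer has the form
   h = (n lambda)^-1 sum_i r_i K(z_i, .), where z_i are the path points and the
   residuals r together with (a1, a2) solve a square linear system, invertible
   because K is positive semidefinite and two of the z_i differ. The system
   depends continuously on time, so by Cramer's rule the pointwise minimizer is
   a continuous, hence measurable and bounded, curve in the space of
   coordinates; it minimizes the integrated energy, and any other minimizer has
   the same energy at almost every time. The vector field is continuous in
   (t, x) and Lipschitz in x, so Picard iteration gives trajectories, and two
   trajectories with gap D satisfy |D'| <= L |D|: then D^2 exp(-2Lt) is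
   nonincreasing (uniqueness) and D^2 exp(2Lt) is nondecreasing (trajectories
   never meet, hence keep their order). *)

Require Import Defs.
From mathcomp Require Import all_boot all_order all_algebra.
From mathcomp Require Import all_classical all_reals all_analysis.
From mathcomp Require Import measurable_realfun.
From mathcomp Require Import ring lra.

Set Implicit Arguments.
Unset Strict Implicit.
Unset Printing Implicit Defensive.

Import Order.TTheory GRing.Theory Num.Theory numFieldNormedType.Exports.

Local Open Scope classical_set_scope.
Local Open Scope ring_scope.

(** * Cauchy-Lipschitz theory on [0, 1] *)

Section CauchyLipschitz.
Context {R : realType}.
Implicit Types (v : R -> R -> R) (phi psi : R -> R).
Notation mu := (@lebesgue_measure R).

(* The clauses of [flow_from_identity] for one initial position. *)
Definition trajectory v (x0 : R) phi : Prop :=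
  [/\ {within `[0, 1], continuous phi},
      phi 0 = x0,
      mu.-integrable `[0, 1] (fun s => (v s (phi s))%:E) &
      forall t : R, t \in `[0, 1] ->
        phi t = x0 + \int[mu]_(s in `[0, t]) v s (phi s)].

Lemma continuous_within_integrable (f : R -> R) (a b : R) :
  {within `[a, b], continuous f} -> mu.-integrable `[a, b] (EFin \o f).
Proof.
by move=> cf; apply: continuous_compact_integrable => //; exact: segment_compact.
Qed.

Lemma within_comp2 v phi (A : set R) :
  continuous (fun p : R * R => v p.1 p.2) ->
  {within A, continuous phi} -> {within A, continuous (fun t => v t (phi t))}.
Proof.
move=> cv /subspace_continuousP cphi; apply/subspace_continuousP => t At.
apply: (@cvg_comp _ _ _ (fun s => (s, phi s)) (fun p : R * R => v p.1 p.2)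
  (within A (nbhs t)) (nbhs (t, phi t))); last exact: (cv (t, phi t)).
have c1 : s @[s --> within A (nbhs t)] --> nbhs t by exact: cvg_within.
exact: cvg_pair c1 (cphi t At).
Qed.

Lemma subset_itv01 (t : R) : t \in `[0, 1] -> `[0, t] `<=` `[0, 1].
Proof. by rewrite in_itv/= => /andP[_ t1]; apply: subset_itvl; rewrite bnd_simp. Qed.

(** The integrand is continuous at an interior time, so the fundamental theorem of calculus
    differentiates the integral. The integral equation is known only on [[0, 1]], which is a
    neighbourhood of [t]. *)
Lemma trajectory_derive v x0 phi (t : R) :
  continuous (fun p : R * R => v p.1 p.2) ->
  trajectory v x0 phi -> t \in `]0, 1[ ->
  is_derive t 1 phi (v t (phi t)).
Proof.
move=> cv [cphi _ iphi phiE] t01.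
have [t0 t1] : 0 < t /\ t < 1 by move: t01; rewrite in_itv/= => /andP.
have cf : {for t, continuous (fun s => v s (phi s))}.
  exact: within_continuous_continuous ltr01 (within_comp2 cv cphi) t01.
have [dF F'] := @continuous_FTC1_closed R _ 0 t 1 t1 iphi t0 cf.
have near_eq : \forall s \near t,
    phi s = x0 + \int[mu]_(u in `[0, s]) v u (phi u).
  have : \forall s \near t, s \in `]0, 1[ by exact: near_in_itvoo.
  by apply: filterS => s s01; apply: phiE; exact: subset_itv_oo_cc.
have eqf : is_derive t 1
    (fun s => x0 + \int[mu]_(u in `[0, s]) v u (phi u)) (v t (phi t)).
  rewrite -[v t _]add0r; apply: is_deriveD.
  by apply: DeriveDef => //; rewrite -derive1E.
by apply: near_eq_is_derive eqf; apply: filterS near_eq => s ->.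
Qed.

(** * Comparison of two trajectories of a Lipschitz field *)

Section Compare.
Variables (v : R -> R -> R) (L : R).
Hypothesis cv : continuous (fun p : R * R => v p.1 p.2).
Hypothesis lipv : forall t a b, `|v t a - v t b| <= L * `|a - b|.

(** The exponent [k] stays free: [- (2 * L)] serves uniqueness and [2 * L] serves the order of
    trajectories. *)
Lemma trajectory_gap_derive (k x0 x1 : R) phi psi (t : R) :
  trajectory v x0 phi -> trajectory v x1 psi -> t \in `]0, 1[ ->
  is_derive t 1 (fun s => (psi s - phi s) ^+ 2 * expR (k * s))
    ((2 * (psi t - phi t) * (v t (psi t) - v t (phi t)) +
      k * (psi t - phi t) ^+ 2) * expR (k * t)).
Proof.
move=> hphi hpsi t01.
have d1 := trajectory_derive cv hphi t01.
have d2 := trajectory_derive cv hpsi t01.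
apply: is_derive_eq.
rewrite /GRing.scale /=.
ring.
Qed.

Lemma within_gap_continuous (k : R) phi psi :
  {within `[0, 1], continuous phi} -> {within `[0, 1], continuous psi} ->
  {within `[0, 1], continuous (fun s => (psi s - phi s) ^+ 2 * expR (k * s))}.
Proof.
move=> /subspace_continuousP cphi /subspace_continuousP cpsi.
apply/subspace_continuousP => t t01; apply: cvgM.
  rewrite expr2; under eq_fun do rewrite expr2.
  by apply: cvgM; apply: cvgB; [exact: cpsi|exact: cphi|exact: cpsi|exact: cphi].
apply: cvg_within_filter.
apply: continuous_comp; last exact: continuous_expR.
by apply: cvgMr; exact: cvg_id.
Qed.

(** Two-sided control of the gap times its derivative; it fixes the sign of the derivative of the
    weighted squared gap whatever the sign of the gap itself. *)
Lemma gap_product_le (t a b : R) :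
  `|(a - b) * (v t a - v t b)| <= L * (a - b) ^+ 2.
Proof.
rewrite normrM -[(a - b) ^+ 2]real_normK ?num_real// expr2 mulrCA.
by apply: ler_wpM2l.
Qed.

(** Gronwall's argument: the weighted squared gap is nonnegative, starts at 0 and cannot
    increase. *)
Lemma trajectory_unique (x0 : R) phi psi :
  trajectory v x0 phi -> trajectory v x0 psi ->
  forall t, t \in `[0, 1] -> psi t = phi t.
Proof.
move=> hphi hpsi t t01.
have [cphi phi0 _ _] := hphi; have [cpsi psi0 _ _] := hpsi.
pose g s := (psi s - phi s) ^+ 2 * expR (- (2 * L) * s).
have gdec : g t <= g 0.
  apply: (@ler0_derive1_le_cc R g 0 1 _ _ _ t 0) => //.
  - by move=> s s01; case: (trajectory_gap_derive (- (2 * L)) hphi hpsi s01).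
  - move=> s s01; rewrite derive1E.
    have [_ ->] := trajectory_gap_derive (- (2 * L)) hphi hpsi s01.
    rewrite mulr_le0_ge0 ?expR_ge0//.
    have := gap_product_le s (psi s) (phi s); rewrite ler_norml => /andP[_].
    by move=> h; lra.
  - exact: within_gap_continuous.
  - by rewrite in_itv/= lexx ler01.
  - by move: t01; rewrite in_itv/= => /andP[].
have : g t <= 0 by apply: le_trans gdec _; rewrite /g phi0 psi0 subrr expr0n mul0r.
rewrite /g pmulr_lle0 ?expR_gt0// => sq0.
apply/eqP; rewrite -subr_eq0 -sqrf_eq0 eq_le sq0 /=.
exact: sqr_ge0.
Qed.

(** The weighted squared gap starts positive and cannot decrease, so the gap never vanishes; by the
    intermediate value theorem it keeps its initial sign. *)
Lemma trajectory_increasing (x0 x1 : R) phi psi :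
  trajectory v x0 phi -> trajectory v x1 psi -> x0 < x1 -> phi 1 < psi 1.
Proof.
move=> hphi hpsi x01.
have [cphi phi0 _ _] := hphi; have [cpsi psi0 _ _] := hpsi.
pose g s := (psi s - phi s) ^+ 2 * expR (2 * L * s).
have ginc t : t \in `[0, 1] -> g 0 <= g t.
  move=> t01; apply: (@ger0_derive1_le_cc R g 0 1 _ _ _ 0 t) => //.
  - by move=> s s01; case: (trajectory_gap_derive (2 * L) hphi hpsi s01).
  - move=> s s01; rewrite derive1E.
    have [_ ->] := trajectory_gap_derive (2 * L) hphi hpsi s01.
    rewrite mulr_ge0 ?expR_ge0//.
    have := gap_product_le s (psi s) (phi s); rewrite ler_norml => /andP[+ _].
    by move=> h; lra.
  - exact: within_gap_continuous.
  - by rewrite in_itv/= lexx ler01.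
  - by move: t01; rewrite in_itv/= => /andP[].
have gap_neq0 t : t \in `[0, 1] -> psi t - phi t != 0.
  move=> /ginc; apply: contraTneq => gap0.
  rewrite -ltNge /g gap0 expr0n /= mul0r mulr_gt0 ?expR_gt0// psi0 phi0.
  by rewrite exprn_gt0// subr_gt0.
rewrite ltNge; apply/negP => psi_le.
have cgap : {within `[0, 1], continuous (fun s => psi s - phi s)}.
  move/subspace_continuousP : cphi => cphi; move/subspace_continuousP : cpsi => cpsi.
  by apply/subspace_continuousP => t t01; apply: cvgB; [exact: cpsi|exact: cphi].
have [||c c01 /eqP] := @IVT R _ 0 1 0 _ cgap => //.
  by rewrite psi0 phi0 ge_min le_max !subr_ge0 (ltW x01) !subr_le0 psi_le orbT.
by apply/negP; exact: gap_neq0.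
Qed.

End Compare.

Lemma halving_small (C e : R) : 0 < e -> exists k : nat, C / 2 ^+ k < e.
Proof.
move=> e0.
have half1 : `|2^-1 : R| < 1 by rewrite ger0_norm ?invr_ge0// invf_lt1// ltr1n.
have /cvgrPdist_lt/(_ e e0) := cvg_geometric C half1.
move=> [k _ /(_ k (leqnn k))] /=; rewrite sub0r normrN exprVn => h.
by exists k; exact: le_lt_trans (ler_norm _) h.
Qed.

(** The intervals with centre [u k] and radius [2 * B / 2 ^+ k] are nested, and the supremum of
    their left endpoints lies in all of them. The explicit rate later makes the convergence of the
    Picard iterates uniform in time. *)
Lemma halving_cauchy (u : nat -> R) (B : R) :
  (forall k, `|u k.+1 - u k| <= B / 2 ^+ k) ->
  exists l, forall k, `|l - u k| <= 2 * B / 2 ^+ k.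
Proof.
move=> hu.
pose c k := B / 2 ^+ k : R.
have cS k : c k = 2 * c k.+1 by rewrite /c exprS invfM; field; rewrite expf_neq0.
have c_ge0 k : 0 <= c k by exact: le_trans (normr_ge0 _) (hu k).
pose a k := u k - 2 * c k; pose b k := u k + 2 * c k.
have aS k : a k <= a k.+1.
  have := hu k; rewrite ler_norml -/(c k) /a (cS k) => /andP[h1 _].
  by move: (c_ge0 k.+1) h1; lra.
have bS k : b k.+1 <= b k.
  have := hu k; rewrite ler_norml -/(c k) /b (cS k) => /andP[_ h1].
  by move: (c_ge0 k.+1) h1; lra.
have a_le_b j k : a j <= b k.
  have ab i : a i <= b i by rewrite /a /b; move: (c_ge0 i); lra.
  have ai i d : a i <= a (i + d)%N.
    by elim: d => [|d]; rewrite ?addn0// addnS => /le_trans; apply.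
  have bi i d : b (i + d)%N <= b i.
    by elim: d => [|d]; rewrite ?addn0// addnS; apply: le_trans.
  apply: le_trans (ai j k) _; apply: le_trans (ab _) _.
  by rewrite addnC; exact: bi.
exists (sup (range a)) => k.
have lower : a k <= sup (range a).
  apply: ub_le_sup; last by exists k.
  by exists (b 0%N) => _ [j _ <-]; exact: a_le_b.
have upper : sup (range a) <= b k.
  by apply: ge_sup; [by exists (a 0%N), 0%N|move=> _ [j _ <-]; exact: a_le_b].
by rewrite -mulrA -/(c k) ler_norml; move: lower upper; rewrite /a /b; lra.
Qed.

(** * Existence of trajectories by Picard iteration *)

Section Picard.
Variables (v : R -> R -> R) (L x0 : R).
Hypothesis cv : continuous (fun p : R * R => v p.1 p.2).
Hypothesis L_gt0 : 0 < L.
Hypothesis lipv : forall t a b, `|v t a - v t b| <= L * `|a - b|.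

Let step phi : R -> R := fun t => x0 + \int[mu]_(s in `[0, t]) v s (phi s).
Let picard k : R -> R := iter k step (cst x0).

Lemma field_integrable phi (t : R) : {within `[0, 1], continuous phi} ->
  t \in `[0, 1] -> mu.-integrable `[0, t] (EFin \o (fun s => v s (phi s))).
Proof.
move=> cphi t01; apply: continuous_within_integrable.
exact: continuous_subspaceW (subset_itv01 t01) (within_comp2 cv cphi).
Qed.

Let one_in : 1 \in (`[0, 1] : interval R).
Proof. by rewrite in_itv/= lexx ler01. Qed.

Lemma picard_step_continuous phi :
  {within `[0, 1], continuous phi} -> {within `[0, 1], continuous (step phi)}.
Proof.
move=> cphi.
have /subspace_continuousP h :=
  @parameterized_integral_continuous R 0 1 _ ler01 (field_integrable cphi one_in).
apply/subspace_continuousP => t t01.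
apply: cvgD; [exact: cvg_cst|exact: h].
Qed.

Lemma picard_continuous k : {within `[0, 1], continuous (picard k)}.
Proof.
elim: k => [|k]; last exact: picard_step_continuous.
by apply: continuous_subspaceT => t; exact: cvg_cst.
Qed.

Lemma expR_scale_continuous (k : R) : continuous (fun s : R => expR (k * s)).
Proof.
move=> s.
apply: (@continuous_comp _ _ _ (fun s : R => k * s) expR); last exact: continuous_expR.
by apply: cvgMr; exact: cvg_id.
Qed.

Lemma within_expR_continuous (k c t : R) :
  {within `[0, t], continuous (fun s : R => c * expR (k * s))}.
Proof.
by apply: continuous_subspaceT => s; apply: cvgMr; exact: expR_scale_continuous.
Qed.

Lemma Rintegral_expR (k t : R) : 0 <= t ->
  \int[mu]_(s in `[0, t]) (k * expR (k * s)) = expR (k * t) - 1.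
Proof.
(* The degenerate interval is treated apart, because the fundamental theorem is applied with
   [0 < t]. *)
rewrite le_eqVlt => /predU1P[<-|t0].
  by rewrite set_itv1 Rintegral_set1 mulr0 expR0 subrr.
have dE (s : R) : is_derive s 1 (fun s => expR (k * s)) (k * expR (k * s)).
  by apply: is_derive_eq; rewrite /GRing.scale/=; ring.
have cE := @expR_scale_continuous k.
rewrite /Rintegral (@continuous_FTC2 R _ (fun s => expR (k * s)) 0 t) //.
- by rewrite mulr0 expR0.
- exact: within_expR_continuous.
- split.
  + by move=> s _; case: (dE s).
  + by apply: cvg_at_right_filter; exact: cE.
  + by apply: cvg_at_left_filter; exact: cE.
- by move=> s _; rewrite derive1E; case: (dE s).
Qed.

(* The weight exp(2Lt) makes an iteration step halve the gap on the whole
   interval, with no smallness condition on L. *)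
Lemma picard_step_gap phi psi (C : R) : 0 <= C ->
  {within `[0, 1], continuous phi} -> {within `[0, 1], continuous psi} ->
  (forall t : R, t \in `[0, 1] -> `|psi t - phi t| <= 2 * C * expR (2 * L * t)) ->
  forall t : R, t \in `[0, 1] -> `|step psi t - step phi t| <= C * expR (2 * L * t).
Proof.
move=> C0 cphi cpsi gap t t01; have [t0 t1] : 0 <= t /\ t <= 1.
  by move: t01; rewrite in_itv/= => /andP.
have iphi := field_integrable cphi t01.
have ipsi := field_integrable cpsi t01.
rewrite /step opprD addrACA subrr add0r -RintegralB//.
have idiff : mu.-integrable `[0, t]
    (EFin \o (fun s => v s (psi s) - v s (phi s))).
  exact: (integrableB _ ipsi iphi).
apply: le_trans (le_normr_Rintegral _ idiff) _ => //.
have bound s : `[0, t]%classic s ->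
    `|v s (psi s) - v s (phi s)| <= C * (2 * L * expR (2 * L * s)).
  move=> s0t; apply: le_trans (lipv _ _ _) _.
  have := gap s (subset_itv01 t01 s0t).
  rewrite -(ler_pM2l L_gt0) => /le_trans; apply.
  by rewrite le_eqVlt; apply/orP; left; apply/eqP; ring.
apply: (@le_trans _ _ (\int[mu]_(s in `[0, t]) (C * (2 * L * expR (2 * L * s))))).
  apply: le_Rintegral => //; first exact: (integrable_norm idiff).
  apply/continuous_within_integrable/continuous_subspaceT => s.
  by do 2 apply: cvgMr; exact: expR_scale_continuous.
rewrite RintegralZl//; last exact/continuous_within_integrable/within_expR_continuous.
by rewrite Rintegral_expR// ler_wpM2l// gerBl.
Qed.

(** The first increment is bounded by compactness, and the weight is at least 1. Each iteration
    halves the weighted bound; replacing the weight by its largest value [expR (2 * L)] makes the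
    bound uniform in time. *)
Lemma picard_gap : exists2 B : R, 0 <= B &
  forall k (t : R), t \in `[0, 1] -> `|picard k.+1 t - picard k t| <= B / 2 ^+ k.
Proof.
have [B0 B0_ge0 hB0] : exists2 B : R, 0 <= B &
    forall t : R, t \in `[0, 1] -> `|picard 1 t - picard 0 t| <= B.
  have : {within `[0, 1], continuous (fun t => `|picard 1 t - picard 0 t|)}.
    have /subspace_continuousP c1 := @picard_continuous 1.
    have /subspace_continuousP c0 := @picard_continuous 0.
    apply/subspace_continuousP => t t01; apply: cvg_norm.
    by apply: cvgB; [exact: c1|exact: c0].
  move=> /(EVT_max ler01)[c _ hc]; exists `|picard 1 c - picard 0 c| => //.
have gap k (t : R) : t \in `[0, 1] ->
    `|picard k.+1 t - picard k t| <= B0 / 2 ^+ k * expR (2 * L * t).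
  elim: k t => [|k IH] t t01.
    have := hB0 t t01; move=> /le_trans; apply; rewrite expr0 divr1 ler_peMr//.
    rewrite -expR0 ler_expR; move: t01; rewrite in_itv/= => /andP[t0 _].
    by rewrite !mulr_ge0// ltW.
  apply: (@picard_step_gap (picard k) (picard k.+1)) => //.
  - by rewrite divr_ge0// exprn_ge0.
  - exact: picard_continuous.
  - exact: picard_continuous.
  - move=> s s01; apply: le_trans (IH s s01) _.
    rewrite le_eqVlt; apply/orP; left; apply/eqP; rewrite exprS invfM.
    by field; rewrite expf_neq0.
exists (B0 * expR (2 * L)); first by rewrite mulr_ge0// expR_ge0.
move=> k t t01; apply: le_trans (gap k t t01) _.
rewrite mulrAC ler_wpM2r ?invr_ge0 ?exprn_ge0// ler_wpM2l// ler_expR.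
move: t01; rewrite in_itv/= => /andP[_ t1].
by rewrite ler_piMr// mulr_ge0// ltW.
Qed.

(** The iterates converge uniformly on [[0, 1]]: the limit inherits continuity, and the Lipschitz
    bound lets the limit pass under the integral. *)
Lemma trajectory_exists : exists phi, trajectory v x0 phi.
Proof.
have [B B_ge0 gap] := picard_gap.
have /choice[phi hphi] : forall t : R, exists l : R, t \in `[0, 1] ->
    forall k, `|l - picard k t| <= 2 * B / 2 ^+ k.
  move=> t; have [t01|_] := boolP (t \in `[0, 1]); last by exists 0.
  by have [l hl] := halving_cauchy (fun k => gap k t t01); exists l.
have cphi : {within `[0, 1], continuous phi}.
  apply/subspace_continuousP => t t01; apply/cvgrPdist_lt => e e0.
  have [k hk] := halving_small (2 * B) (divr_gt0 e0 (ltr0Sn R 2)).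
  have /subspace_continuousP/(_ t t01)/cvgrPdist_lt := @picard_continuous k.
  move=> /(_ (e / 3) (divr_gt0 e0 (ltr0Sn R 2))) near_t.
  have in01 : within `[0, 1]%classic (nbhs t) `[0, 1]%classic.
    by apply: withinT; exact: nbhs_filter.
  apply: filterS2 in01 near_t => s s01 hs.
  have h1 := le_lt_trans (hphi t t01 k) hk.
  have h2 := le_lt_trans (hphi s s01 k) hk.
  rewrite (_ : phi t - phi s = (phi t - picard k t) +
    ((picard k t - picard k s) - (phi s - picard k s))); last by ring.
  apply: le_lt_trans (ler_normD _ _) _.
  have := ler_normB (picard k t - picard k s) (phi s - picard k s).
  by move: h1 h2 hs; lra.
have phiE t : t \in `[0, 1] -> phi t = step phi t.
  move=> t01; have [t0 t1] : 0 <= t /\ t <= 1.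
    by move: t01; rewrite in_itv/= => /andP.
  apply/eqP; rewrite -subr_eq0 -normr_le0 leNgt; apply/negP => d0.
  (* Both sides of the equation are compared with the iterate of rank [k.+1]: the limit is within
     [B / 2 ^+ k] of it, and [step phi t] within [2 * L * B / 2 ^+ k]. *)
  have [k hk] := halving_small (B + 2 * L * B) d0.
  move: hk; apply/negP; rewrite -leNgt.
  have h1 := hphi t t01 k.+1.
  have h2 : `|picard k.+1 t - step phi t| <= 2 * L * B / 2 ^+ k.
    rewrite /= /step opprD addrACA subrr add0r.
    have iphi := field_integrable cphi t01.
    have ipic := field_integrable (@picard_continuous k) t01.
    rewrite -RintegralB//.
    have idiff : mu.-integrable `[0, t]
        (EFin \o (fun s => v s (picard k s) - v s (phi s))).
      exact: (integrableB _ ipic iphi).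
    apply: le_trans (le_normr_Rintegral _ idiff) _ => //.
    apply: (@le_trans _ _ (\int[mu]_(s in `[0, t]) (2 * L * B / 2 ^+ k))).
      apply: le_Rintegral => //.
      - exact: (integrable_norm idiff).
      - apply: continuous_within_integrable; apply: continuous_subspaceT => s.
        exact: cvg_cst.
      - move=> s s0t; apply: le_trans (lipv _ _ _) _.
        have := hphi s (subset_itv01 t01 s0t) k.
        rewrite distrC -(ler_pM2l L_gt0) => /le_trans; apply.
        by rewrite le_eqVlt; apply/orP; left; apply/eqP; ring.
    rewrite Rintegral_cst//.
    rewrite [X in fine X](_ : _ = t%:E); last first.
      apply: (etrans (lebesgue_measure_itv _)); rewrite /= lte_fin.
      by case: ltP t0 => [_ _|t0 t0']; rewrite ?sube0//; congr EFin; lra.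
    have c0 : 0 <= 2 * L * B / 2 ^+ k by rewrite !mulr_ge0 ?invr_ge0 ?exprn_ge0// ltW.
    by rewrite ler_piMr.
  rewrite (_ : phi t - step phi t = (phi t - picard k.+1 t) +
    (picard k.+1 t - step phi t)); last by ring.
  apply: le_trans (ler_normD _ _) _; apply: le_trans (lerD h1 h2) _.
  rewrite le_eqVlt; apply/orP; left; apply/eqP; rewrite exprS.
  by field; rewrite expf_neq0.
exists phi; split => //; last exact: (field_integrable cphi one_in).
have zero_in : 0 \in (`[0, 1] : interval R) by rewrite in_itv/= lexx ler01.
by rewrite (phiE _ zero_in) /step set_itv1 Rintegral_set1 addr0.
Qed.

End Picard.

End CauchyLipschitz.

(** * Reproducing kernel Hilbert spaces *)

Lemma continuous_pair_comp {T U V W : topologicalType} (F : U * V -> W)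
    (f : T -> U) (g : T -> V) :
  continuous F -> continuous f -> continuous g -> continuous (fun t => F (f t, g t)).
Proof.
move=> cF cf cg t.
apply: (@cvg_comp _ _ _ (fun t => (f t, g t)) F _ (nbhs (f t, g t))).
  exact: cvg_pair (cf t) (cg t).
exact: cF.
Qed.

Lemma continuous_compT {T U V : topologicalType} (f : T -> U) (g : U -> V) :
  continuous f -> continuous g -> continuous (g \o f).
Proof. by move=> cf cg t; apply: continuous_comp; [exact: cf|exact: cg]. Qed.

Section RkhsGeometry.
Context {R : realType} {K : R -> R -> R} (H : rkhs K).
Implicit Types (h g : H) (x z : R).

Notation ev := (rkhs_fun H).
Notation dot := (rkhs_dot H).
Notation sec := (rkhs_section H).

Lemma rkhs_dotC h g : dot h g = dot g h.
Proof. by rewrite hermC expr0 mul1r. Qed.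

Lemma rkhs_normD h g : `|h + g| ^+ 2 = `|h| ^+ 2 + 2 * dot h g + `|g| ^+ 2.
Proof.
rewrite -!rkhs_dot_norm linearDl !linearDr/= (rkhs_dotC g h).
by rewrite mulr_natl mulr2n !addrA.
Qed.

Lemma rkhs_evD h g x : ev (h + g) x = ev h x + ev g x.
Proof. by rewrite linearD. Qed.

Lemma rkhs_evB h g x : ev (h - g) x = ev h x - ev g x.
Proof. by rewrite linearB. Qed.

Lemma rkhs_evZ (c : R) h x : ev (c *: h) x = c * ev h x.
Proof. by rewrite linearZ. Qed.

Lemma rkhs_ev_sum (I : Type) (r : seq I) (P : pred I) (F : I -> H) x :
  ev (\sum_(i <- r | P i) F i) x = \sum_(i <- r | P i) ev (F i) x.
Proof.
elim/big_rec2: _ => [|i a b _ <-]; first by rewrite linear0.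
by rewrite rkhs_evD.
Qed.

Lemma rkhs_dot_sectionl h x : dot (sec x) h = ev h x.
Proof. by rewrite rkhs_dotC rkhs_reproducing. Qed.

Lemma rkhs_dot_sections x z : dot (sec x) (sec z) = K x z.
Proof. by rewrite rkhs_reproducing rkhs_sectionE. Qed.

Lemma rkhs_section_dist x z :
  `|sec x - sec z| ^+ 2 = K x x - 2 * K x z + K z z.
Proof.
rewrite rkhs_normD normrN -!rkhs_dot_norm !rkhs_dot_sections linearNr/= rkhs_dot_sections.
ring.
Qed.

(** The squared distance between two sections is a combination of kernel values, which vanishes on
    the diagonal. *)
Lemma rkhs_section_continuous :
  continuous (fun z : R * R => K z.1 z.2) -> continuous sec.
Proof.
move=> cK x; apply/cvgrPdist_lt => e e0.
have cdiag (f g : R -> R) : continuous f -> continuous g ->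
    continuous (fun z => K (f z) (g z)).
  by move=> cf cg; apply: (continuous_pair_comp cK).
have : continuous (fun z => K x x - 2 * K x z + K z z).
  move=> z; apply: cvgD; last by apply: (cdiag id id) => ?; exact: cvg_id.
  apply: cvgB; first exact: cvg_cst.
  apply: cvgMr; apply: (cdiag (cst x) id) => ?; [exact: cvg_cst|exact: cvg_id].
move=> /(_ x)/cvgrPdist_lt/(_ (e ^+ 2) (exprn_gt0 _ e0)).
apply: filterS => z; rewrite -!rkhs_section_dist subrr normr0 expr0n/= sub0r normrN.
by rewrite ger0_norm ?sqr_ge0// ltr_pXn2r// ?nnegrE// ltW.
Qed.

(** For a unit vector [g], nonnegativity of the squared norms of [g + sec x] and [g - sec x] gives
    [2 * |g(x)| <= 1 + K x x]; the general case follows by scaling. Any constant independent of [x]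
    suffices below. *)
Lemma rkhs_eval_le (M : R) h x : (forall z, K z z <= M) ->
  `|ev h x| <= (1 + M) / 2 * `|h|.
Proof.
move=> KM.
have unit_case g : `|g| = 1 -> `|ev g x| <= (1 + M) / 2.
  move=> g1; have xx := KM x.
  have h1 : 0 <= `|g + sec x| ^+ 2 by exact: sqr_ge0.
  have h2 : 0 <= `|g - sec x| ^+ 2 by exact: sqr_ge0.
  move: h1 h2; rewrite !rkhs_normD normrN linearNr/= rkhs_reproducing g1.
  rewrite -rkhs_dot_norm rkhs_dot_sections ler_norml expr1n.
  by move=> h1 h2; apply/andP; split; lra.
have [->|h0] := eqVneq h 0; first by rewrite linear0 !normr0 mulr0.
have nh : 0 < `|h| by rewrite normr_gt0.
have {1}-> : h = `|h| *: (`|h|^-1 *: h) by rewrite scalerA divff ?gt_eqF// scale1r.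
rewrite rkhs_evZ normrM normr_id mulrC ler_pM2r//.
apply: unit_case; rewrite normrZ normrV ?unitfE ?gt_eqF// normr_id mulVf//.
by rewrite gt_eqF.
Qed.

(** Moving the point costs the Lipschitz bound for the fixed [h]; moving the function costs the
    uniform evaluation bound. *)
Lemma rkhs_eval_continuous (M C : R) : (forall z, K z z <= M) ->
  (forall h x z, `|ev h x - ev h z| <= C * `|h| * `|x - z|) ->
  continuous (fun q : R * H => ev q.2 q.1).
Proof.
move=> KM lip [x h]; apply/cvgrPdist_lt => e e0 /=.
have M0 : 0 <= (1 + M) / 2.
  have := KM 0; rewrite -rkhs_dot_sections rkhs_dot_norm.
  by have := sqr_ge0 `|sec 0|; lra.
(* The sign of [C] is not known; the absolute value keeps the majorant nonnegative. *)
have : (fun q : R * H => `|C * `|h| | * `|x - q.1| + (1 + M) / 2 * `|h - q.2|) q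
    @[q --> (x, h)] --> `|C * `|h| | * `|x - x| + (1 + M) / 2 * `|h - h|.
  apply: cvgD; apply: cvgMr; apply: cvg_norm; apply: cvgB; try exact: cvg_cst.
    exact: cvg_fst.
  exact: cvg_snd.
rewrite !subrr !normr0 !mulr0 addr0 => /cvgrPdist_lt/(_ e e0).
apply: filterS => -[x' h'] /=; rewrite sub0r normrN ger0_norm; last first.
  by rewrite addr_ge0// mulr_ge0.
apply: le_lt_trans.
rewrite (_ : ev h x - ev h' x' = (ev h x - ev h x') + ev (h - h') x'); last first.
  by rewrite rkhs_evB; ring.
apply: le_trans (ler_normD _ _) _; apply: lerD; last exact: rkhs_eval_le.
apply: le_trans (lip _ _ _) _.
by rewrite ler_wpM2r// ler_norm.
Qed.

(** Elements of the space are bounded, which kills the slope; the function is then constant, and a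
    constant is square integrable on the whole line only if it is 0. *)
Lemma affine_rkhs_eq0 (a b : R) h (M : R) :
  (forall z, K z z <= M) ->
  (rkhs_fun H h : R -> R) \in Lfun lebesgue_measure 2%:E ->
  (forall x, a + b * x + ev h x = 0) -> [/\ a = 0, b = 0 & h = 0].
Proof.
move=> KM hL2 h_affine.
have b0 : b = 0.
  apply/eqP/negPn/negP => b_neq0.
  pose B := (1 + M) / 2 * `|h|.
  have bound x : `|ev h x| <= B by exact: rkhs_eval_le.
  (* At this point the affine part equals [B + 1], beyond the bound [B] on the values of [h]. *)
  have e1 := h_affine ((B + 1 - a) / b).
  have := bound ((B + 1 - a) / b).
  rewrite (_ : b * _ = B + 1 - a) in e1; last by field.
  by rewrite ler_norml => /andP[+ _]; lra.
have hE x : ev h x = - a by have := h_affine x; rewrite b0; lra.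
have a0 : a = 0.
  apply/eqP/negPn/negP => a_neq0.
  have /integrableP[_] := Lfun2_integrable_sqr hL2.
  rewrite (eq_integral (cst (a ^+ 2)%:E)); last first.
    by move=> x _ /=; rewrite hE sqrrN ger0_norm ?sqr_ge0.
  rewrite integral_cst// [X in (_ * X)%E](_ : _ = +oo%E); last first.
    by rewrite -set_itvNyy; exact: (lebesgue_measure_itv `]-oo, +oo[).
  by rewrite gt0_muley ?ltxx// lte_fin exprn_even_gt0.
split => //; apply: (@rkhs_fun_inj _ _ H).
by apply/funext => x; rewrite hE a0 oppr0 linear0.
Qed.

End RkhsGeometry.

(** * Coordinates, topology and measurability in the affine extension *)

Section AffineExtensionTopology.
Context {R : realType} {K : R -> R -> R} (H : rkhs K).
Hypothesis affine_inj : injective (@affine_plus R K H).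

Notation coords := (R * R * H)%type.
Implicit Types (p q : coords) (f : R -> R).

Lemma decompK : cancel (@affine_plus R K H) (decomp H).
Proof.
move=> p; apply: affine_inj.
by apply: (@xgetPex _ 0 [set q | affine_plus q = affine_plus p]); exists p.
Qed.

Lemma Htilde_decomp f : Htilde H f -> affine_plus (decomp H f) = f.
Proof. by move=> [p _ <-]; rewrite decompK. Qed.

Lemma affine_plusD p q x : affine_plus (p + q) x = affine_plus p x + affine_plus q x.
Proof. by rewrite /affine_plus /= rkhs_evD; ring. Qed.

Lemma affine_plusB p q : affine_plus p \- affine_plus q = affine_plus (p - q).
Proof. apply/funext => x; rewrite /affine_plus /= rkhs_evB. ring. Qed.

(** The norm of the product [R * R] is already the maximum of the two absolute values. *)
Lemma Htilde_norm_affine_plus p :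
  Htilde_norm H (affine_plus p) = `|p.1| + `|p.2|.
Proof.
by rewrite /Htilde_norm /affine_cst /affine_slope /rkhs_part decompK prod_normE.
Qed.

(** The maximum norm of [coords] is at most the sum norm of [Htilde]. This transfers measurability
    of a vector field to its curve of coordinates. *)
Lemma Htilde_open_decomp (A : set coords) : open A ->
  Htilde_open H [set f | Htilde H f /\ A (decomp H f)].
Proof.
move=> oA; split; first by move=> f [].
move=> _ [[p _ <-]]; rewrite decompK => Ap.
have /nbhs_ballP[e /= e0 pe] := open_nbhs_nbhs (conj oA Ap).
exists e => // _ [q _ <-]; rewrite affine_plusB Htilde_norm_affine_plus => pq.
split; first by exists q.
rewrite decompK; apply: pe; rewrite -ball_normE /= distrC.
apply: le_lt_trans pq; rewrite prod_normE ge_max lerDl lerDr.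
by rewrite le_max !normr_ge0.
Qed.

(** The sum norm is at most twice the maximum norm, hence the radius [e / 2]. *)
Lemma open_affine_plus_preimage (U : set (R -> R)) :
  Htilde_open H U -> open (@affine_plus R K H @^-1` U).
Proof.
move=> [_ oU]; rewrite openE => p Up; have [e e0 pe] := oU _ Up.
apply/nbhs_ballP; exists (e / 2) => /=; first by rewrite divr_gt0.
move=> q; rewrite -ball_normE /= distrC prod_normE gt_max => /andP[h1 h2].
apply: pe; first by exists q.
by rewrite affine_plusB Htilde_norm_affine_plus (splitr e) ltrD.
Qed.

Lemma vector_fields_affine_plus (p : R -> coords) : continuous p ->
  vector_fields H (fun t => affine_plus (p t)).
Proof.
move=> cp; split; first by move=> t _; exists (p t).
move=> U /open_affine_plus_preimage oU.
rewrite (_ : [set _ | _] =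
    `[0, 1]%classic `&` (p @^-1` (@affine_plus R K H @^-1` U))); last first.
  by apply/seteqP; split.
apply: measurableI => //; apply: open_measurable.
by apply: open_comp => // t _; exact: cp.
Qed.

(* The time axis is second countable although [H] need not be: cover [W] by
   products of rational intervals with open sets of coordinates. *)
Lemma measurable_time_section (w : R -> R -> R) (W : set (R * coords)) :
  vector_fields H w -> open W ->
  measurable ([set t : R | t \in `[0, 1] /\ W (t, decomp H (w t))]
                : set (measurableTypeR R)).
Proof.
move=> [wH mw] oW.
(* The largest open set of coordinates whose product with the interval from [a] to [b] lies in
   [W]. *)
pose slab (a b : rat) : set coords :=
  [set p | forall t : R, ratr a < t < ratr b -> W (t, p)]°.
have -> : [set t : R | t \in `[0, 1] /\ W (t, decomp H (w t))] =
    \bigcup_a \bigcup_b ([set t : R | t \in `[0, 1] /\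
      (Htilde H (w t) /\ slab a b (decomp H (w t)))] `&`
      `](ratr a : R), ratr b[%classic).
  apply/seteqP; split => t /=; last first.
    move=> [a _ [b _ [[t01 [_ /interior_subset ab]]]]].
    by rewrite /= in_itv/= => tab; split => //; exact: ab.
  move=> [t01 Wt]; have Hwt := wH t t01.
  (* A ball of the product is a product of balls, so rational endpoints within [e] of [t] on either
     side give an admissible slab. *)
  have /nbhs_ballP[e /= e0 be] := open_nbhs_nbhs (conj oW Wt).
  have [a /[!in_itv]/= /andP[a1 a2]] : exists a : rat, ratr a \in `]t - e, t[.
    by apply: rat_in_itvoo; rewrite gtrBl.
  have [b /[!in_itv]/= /andP[b1 b2]] : exists b : rat, ratr b \in `]t, t + e[.
    by apply: rat_in_itvoo; rewrite ltrDl.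
  exists a => //; exists b => //; split; last by rewrite /= in_itv/= a2.
  split=> //; split=> //; apply/nbhs_ballP; exists e => // p pe s /andP[s1 s2].
  apply: be; split => //=; rewrite -ball_normE /= ltr_distlC; apply/andP; split; lra.
apply: bigcupT_measurable_rat => a; apply: bigcupT_measurable_rat => b.
apply: measurableI => //.
have oS : open (slab a b) by exact: open_interior.
by have := mw _ (Htilde_open_decomp oS).
Qed.

(** Open intervals generate the Borel sets, and their preimages under [F] are open. The
    measurability of every integrand below is reduced to this form. *)
Lemma measurable_along (w : R -> R -> R) (F : R * coords -> R) :
  vector_fields H w -> continuous F ->
  measurable_fun (`[0, 1] : set (measurableTypeR R))
    (fun t : R => F (t, decomp H (w t)) : measurableTypeR R).
Proof.
move=> vw cF mD; apply: (measurability _ (RGenOpens.measurableE R)) => //.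
move=> _ [_ [a [b ->] <-]].
apply: (measurable_time_section (W := F @^-1` `]a, b[%classic)) => //.
by apply: open_comp => // q _; exact: cF.
Qed.

End AffineExtensionTopology.

(** * The smoothing problem at a fixed time *)

Section ContinuousSolve.
Context {R : realType} {T : topologicalType}.

Lemma continuous_bigsum (I : Type) (r : seq I) (P : pred I) (V : normedModType R)
    (f : I -> T -> V) :
  (forall i, P i -> continuous (f i)) ->
  continuous (fun t => \sum_(i <- r | P i) f i t).
Proof.
move=> cf t; apply: (@cvg_big V I +%R 0 P) => [z|i Pi]; last exact: cf.
exact: add_continuous.
Qed.

Lemma continuous_bigprod (I : Type) (r : seq I) (f : I -> T -> R) :
  (forall i, continuous (f i)) -> continuous (fun t => \prod_(i <- r) f i t).
Proof.
move=> cf t; apply: (@cvg_big R I *%R 1 xpredT) => [z|i _]; last exact: cf.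
exact: mul_continuous.
Qed.

Lemma continuous_det m (A : T -> 'M[R]_m) :
  (forall i j, continuous (fun t => A t i j)) -> continuous (fun t => \det (A t)).
Proof.
move=> cA; rewrite /determinant.
apply: (@continuous_bigsum _ _ _ R) => s _ t; apply: cvgMr.
by apply: continuous_bigprod => i; exact: cA.
Qed.

Lemma continuous_adj m (A : T -> 'M[R]_m) (i j : 'I_m) :
  (forall i j, continuous (fun t => A t i j)) ->
  continuous (fun t => (\adj (A t)) i j).
Proof.
move=> cA; rewrite (_ : (fun t => _) = (fun t => cofactor (A t) j i)); last first.
  by apply/funext => t; rewrite mxE.
rewrite /cofactor => t; apply: cvgMr.
apply: (continuous_det (A := fun t => row' j (col' i (A t)))) => k l.
rewrite (_ : (fun t => _) = (fun t => A t (lift j k) (lift i l))); first exact: cA.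
by apply/funext => s; rewrite !mxE.
Qed.

Lemma continuous_linear_solve m (A : T -> 'M[R]_m) (b : 'cV[R]_m) :
  (forall i j, continuous (fun t => A t i j)) ->
  (forall t (u : 'cV_m), A t *m u = 0 -> u = 0) ->
  exists u : T -> 'cV[R]_m,
    (forall i, continuous (fun t => u t i 0)) /\ forall t, A t *m u t = b.
Proof.
move=> cA A_inj.
have det_neq0 t : \det (A t) != 0.
  (* [kermx] is a left kernel, so the hypothesis on columns is applied to the transpose. *)
  rewrite -unitfE -unitmxE -unitmx_tr -row_free_unit -kermx_eq0.
  apply/eqP/row_matrixP => i; rewrite row0; apply: trmx_inj; rewrite trmx0.
  by apply: (A_inj t); rewrite -{1}(trmxK (A t)) -trmx_mul -row_mul mulmx_ker row0 trmx0.
exists (fun t => (\det (A t))^-1 *: (\adj (A t) *m b)); split => [i t|t].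
  rewrite (_ : (fun t => _) =
      (fun t => (\det (A t))^-1 * \sum_j (\adj (A t)) i j * b j 0)); last first.
    by apply/funext => s; rewrite mxE mxE.
  apply: cvgM; first by apply: cvgV => //; exact: continuous_det.
  apply: (@continuous_bigsum _ _ _ R) => j _ s; apply: cvgMl.
  exact: continuous_adj.
by rewrite -scalemxAr mulmxA mul_mx_adj mul_scalar_mx scalerA mulVf// scale1r.
Qed.

End ContinuousSolve.

(** * The optimality system and its invertibility *)

Section KKT.
Context {R : realType} (K : R -> R -> R).
Hypothesis K_pd : positive_definite_kernel K.
Hypothesis cK : continuous (fun z : R * R => K z.1 z.2).
Variables (n : nat) (c : R).
Hypothesis n_gt1 : (1 < n)%N.
Hypothesis c_ge0 : 0 <= c.

(** Pairing the stationarity equations with [r] removes the affine terms and leaves the sum of the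
    squares of [r] plus a nonnegative kernel form, with total 0. So [r] vanishes, and then the
    affine function vanishes at two distinct points. *)
Lemma kkt_kernel (z r : 'I_n -> R) (a b : R) : injective z ->
  (forall i, r i + c * \sum_j r j * K (z j) (z i) + (a + b * z i) = 0) ->
  \sum_i r i = 0 -> \sum_i r i * z i = 0 ->
  [/\ forall i, r i = 0, a = 0 & b = 0].
Proof.
move=> z_inj stat r1 rz.
have quad : \sum_i r i ^+ 2 +
    c * \sum_i \sum_j r i * r j * K (z i) (z j) = 0.
  have : \sum_i r i * (r i + c * \sum_j r j * K (z j) (z i) + (a + b * z i)) = 0.
    by rewrite big1// => i _; rewrite stat mulr0.
  rewrite (eq_bigr (fun i => (r i ^+ 2 + c * \sum_j r i * r j * K (z i) (z j)) +
    (a * r i + b * (r i * z i)))); last first.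
    move=> i _.
    rewrite [X in _ = _ + c * X + _](_ : _ = r i * \sum_j r j * K (z j) (z i)).
      by ring.
    by rewrite mulr_sumr; apply: eq_bigr => j _; rewrite (K_pd.1 (z j)) mulrA.
  rewrite big_split /= big_split /= -mulr_sumr.
  by rewrite big_split/= -!mulr_sumr r1 rz !mulr0 !addr0.
have sq0 : \sum_i r i ^+ 2 = 0.
  have h1 : 0 <= \sum_i r i ^+ 2 by apply: sumr_ge0 => i _; exact: sqr_ge0.
  have := mulr_ge0 c_ge0 (K_pd.2 n z r).
  by move: quad h1; lra.
have r0 i : r i = 0.
  move: sq0 => /eqP; rewrite psumr_eq0; last by move=> j _; exact: sqr_ge0.
  by move=> /allP/(_ i (mem_index_enum _)); rewrite sqrf_eq0 => /eqP.
have line i : a + b * z i = 0.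
  by have := stat i; rewrite r0 big1 ?mulr0 ?add0r// => j _; rewrite r0 mul0r.
have n_gt0 := ltnW n_gt1.
pose i0 := Ordinal n_gt0; pose i1 := Ordinal n_gt1.
have z01 : z i1 - z i0 != 0.
  by rewrite subr_eq0; apply/eqP => /z_inj/(congr1 val).
have b0 : b = 0.
  apply: (mulIf z01); rewrite mul0r mulrBr.
  by have := line i0; have := line i1; lra.
by split => //; have := line i0; rewrite b0 mul0r addr0.
Qed.

(* Unknowns: the residuals r, then the intercept and the slope; the last two
   rows say that r is orthogonal to the affine functions. *)
Definition kkt_mx (z : 'I_n -> R) : 'M[R]_(n + 2) :=
  block_mx (1%:M + \matrix_(i, j) (c * K (z j) (z i)))
           (\matrix_(i, j) (if j == 0 then 1 else z i))
           (\matrix_(j, i) (if j == 0 then 1 else z i)) 0.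

Lemma kkt_mxE (z : 'I_n -> R) (u : 'cV_(n + 2)) (r := fun i => u (lshift 2 i) 0)
    (a := u (rshift n 0) 0) (b := u (rshift n 1) 0) :
  [/\ forall i, (kkt_mx z *m u) (lshift 2 i) 0 =
        r i + c * \sum_j r j * K (z j) (z i) + (a + b * z i),
      (kkt_mx z *m u) (rshift n 0) 0 = \sum_i r i &
      (kkt_mx z *m u) (rshift n 1) 0 = \sum_i r i * z i].
Proof.
have dE i : dsubmx u i 0 = u (rshift n i) 0 by rewrite mxE.
have uE i : usubmx u i 0 = r i by rewrite mxE.
rewrite -{1 2 3}(vsubmxK u) mul_block_col mul0mx addr0; split.
- move=> i; rewrite col_mxEu mulmxDl mul1mx !mxE big_ord_recl big_ord1 !mxE /=.
  rewrite mul1r; congr (_ + _ + _).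
  + rewrite mulr_sumr; apply: eq_bigr => j _; rewrite !mxE.
    by rewrite -!mulrA (mulrC (K _ _)).
  + by rewrite mulrC; congr (_ + u _ _ * _); apply: val_inj.
- by rewrite col_mxEd !mxE; apply: eq_bigr => i _; rewrite !mxE /= mul1r.
- by rewrite col_mxEd !mxE; apply: eq_bigr => i _; rewrite !mxE /= mulrC.
Qed.

Lemma kkt_solution (z : R -> 'I_n -> R) (w : 'I_n -> R) :
  (forall i, continuous (fun t => z t i)) -> (forall t, injective (z t)) ->
  exists (r : R -> 'I_n -> R) (a b : R -> R),
  [/\ forall i, continuous (fun t => r t i), continuous a & continuous b] /\
  forall t, [/\ forall i, r t i + c * \sum_j r t j * K (z t j) (z t i) +
                  (a t + b t * z t i) = w i,
                \sum_i r t i = 0 & \sum_i r t i * z t i = 0].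
Proof.
move=> cz z_inj.
have cM i j : continuous (fun t => kkt_mx (z t) i j).
  have cKz k l : continuous (fun t => K (z t k) (z t l)).
    by apply: (continuous_pair_comp cK).
  case: (split_ordP i) => k ->; case: (split_ordP j) => l ->.
  - rewrite (_ : (fun t => _) =
        (fun t => (k == l)%:R + c * K (z t l) (z t k))); last first.
      by apply/funext => t; rewrite block_mxEul !mxE.
    by move=> t; apply: cvgD; [exact: cvg_cst|apply: cvgMr; exact: cKz].
  - rewrite (_ : (fun t => _) = (fun t => if l == 0 then 1 else z t k : R)).
      by case: (l == 0); [move=> t; exact: cvg_cst|exact: cz].
    by apply/funext => t; rewrite block_mxEur mxE.
  - rewrite (_ : (fun t => _) = (fun t => if k == 0 then 1 else z t l : R)).
      by case: (k == 0); [move=> t; exact: cvg_cst|exact: cz].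
    by apply/funext => t; rewrite block_mxEdl mxE.
  - rewrite (_ : (fun t => _) = fun=> 0 : R); first by move=> t; exact: cvg_cst.
    by apply/funext => t; rewrite block_mxEdr mxE.
have M_inj t (u : 'cV_(n + 2)) : kkt_mx (z t) *m u = 0 -> u = 0.
  move=> Mu0; have [E1 E2 E3] := kkt_mxE (z t) u.
  move: E1 E2 E3; rewrite Mu0 !mxE => E1 E2 E3.
  have [r0 a0 b0] := kkt_kernel (z_inj t)
    (fun i => etrans (esym (E1 i)) (mxE _ _ _ _)) (esym E2) (esym E3).
  apply/colP => i; rewrite mxE; case: (split_ordP i) => k -> //.
  case: k => -[|[|//]] kP; [rewrite -a0|rewrite -b0]; congr (u (rshift _ _) _);
    exact: val_inj.
have [u [cu uE]] := continuous_linear_solve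
  (col_mx (\col_i w i) 0) cM M_inj.
exists (fun t i => u t (lshift 2 i) 0), (fun t => u t (rshift n 0) 0),
  (fun t => u t (rshift n 1) 0).
split=> [|t]; first by split; [move=> i| |]; exact: cu.
have [E1 E2 E3] := kkt_mxE (z t) (u t).
move: E1 E2 E3; rewrite (uE t) !col_mxEd !mxE => E1 E2 E3; split => //.
by move=> i; rewrite -E1 col_mxEu mxE.
Qed.

End KKT.

(** * Minimality and uniqueness for the smoothing energy *)

Section Smoothing.
Context {R : realType} {K : R -> R -> R} (H : rkhs K).
Variables (n : nat) (lambda : R) (z w : 'I_n -> R).
Hypothesis n_gt1 : (1 < n)%N.
Hypothesis lambda_gt0 : 0 < lambda.

Notation coords := (R * R * H)%type.

Definition smoothing_energy (p : coords) : R :=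
  n%:R^-1 * \sum_(i < n) (w i - affine_plus p (z i)) ^+ 2 + lambda * `|p.2| ^+ 2.

Let c : R := (n%:R * lambda)^-1.

(** With this factor [c], [lambda] times the inner product with [g] is the mean of the products
    [r i * g(z i)]: the first-order condition in the direction [g]. *)
Definition kernel_combination (r : 'I_n -> R) : H :=
  \sum_(i < n) (c * r i) *: rkhs_section H (z i).

Lemma kernel_combinationE r u :
  rkhs_fun H (kernel_combination r) u = c * \sum_(i < n) r i * K (z i) u.
Proof.
rewrite rkhs_ev_sum mulr_sumr; apply: eq_bigr => i _.
by rewrite rkhs_evZ rkhs_sectionE mulrA.
Qed.

Lemma kernel_combination_dot r (g : H) :
  rkhs_dot H (kernel_combination r) g = c * \sum_(i < n) r i * rkhs_fun H g (z i).
Proof.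
rewrite /kernel_combination mulr_sumr linear_sumlz/=; apply: eq_bigr => i _.
by rewrite linearZl_LR/= rkhs_dot_sectionl mulrA.
Qed.

Variables (r : 'I_n -> R) (a b : R).
Hypothesis stationary : forall i,
  r i + c * \sum_(j < n) r j * K (z j) (z i) + (a + b * z i) = w i.
Hypothesis r_sum0 : \sum_(i < n) r i = 0.
Hypothesis rz_sum0 : \sum_(i < n) r i * z i = 0.

Let p : coords := ((a, b), kernel_combination r).

(** The expansion of a quadratic function at a critical point: the linear terms of the residual and
    of the penalty cancel. The nonnegative remainder yields both minimality and uniqueness. *)
Lemma smoothing_energyD (q : coords) :
  smoothing_energy (p + q) = smoothing_energy p +
    (n%:R^-1 * \sum_(i < n) affine_plus q (z i) ^+ 2 + lambda * `|q.2| ^+ 2).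
Proof.
have n_neq0 : n%:R != 0 :> R by rewrite pnatr_eq0 -lt0n ltnW.
have l_neq0 : lambda != 0 by rewrite gt_eqF.
have rE i : w i - affine_plus p (z i) = r i.
  by rewrite -stationary /affine_plus /p /= kernel_combinationE; ring.
set d := fun i => affine_plus q (z i).
(* The residuals are orthogonal to affine functions, so only the part of [q] in [H] contributes. *)
have cross : \sum_(i < n) r i * d i = \sum_(i < n) r i * rkhs_fun H q.2 (z i).
  rewrite (eq_bigr (fun i => q.1.1 * r i + q.1.2 * (r i * z i) +
    r i * rkhs_fun H q.2 (z i))); last by move=> i _; rewrite /d /affine_plus; ring.
  by rewrite !big_split/= -!mulr_sumr r_sum0 rz_sum0 !mulr0 !add0r.
have resE : \sum_(i < n) (w i - affine_plus (p + q) (z i)) ^+ 2 =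
    \sum_(i < n) r i ^+ 2 - 2 * (\sum_(i < n) r i * d i) + \sum_(i < n) d i ^+ 2.
  rewrite mulr_sumr -sumrB -big_split; apply: eq_bigr => i _ /=.
  by rewrite affine_plusD -(rE i) /d; ring.
rewrite /smoothing_energy resE rkhs_normD kernel_combination_dot cross.
rewrite [in RHS](eq_bigr (fun i => r i ^+ 2)); last by move=> i _; rewrite rE.
rewrite /c; move: (\sum_(i < n) r i ^+ 2) (\sum_(i < n) d i ^+ 2) => s1 s2.
move: (\sum_(i < n) _) => s3; rewrite -/d.
by field; rewrite n_neq0.
Qed.

Lemma smoothing_energy_min (q : coords) : smoothing_energy p <= smoothing_energy q.
Proof.
rewrite -(subrKC p q) smoothing_energyD lerDl.
rewrite addr_ge0// mulr_ge0 ?sqr_ge0 ?(ltW lambda_gt0)//.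
by apply: sumr_ge0 => i _; exact: sqr_ge0.
Qed.

(** The remainder must vanish: its penalty term kills the part in [H], and its data term then makes
    an affine function vanish at two distinct points. *)
Lemma smoothing_energy_unique (q : coords) : injective z ->
  smoothing_energy q <= smoothing_energy p -> q = p.
Proof.
move=> z_inj; rewrite -{1}(subrKC p q) smoothing_energyD gerDl.
set u := q - p.
have sum_ge0 : 0 <= \sum_(i < n) affine_plus u (z i) ^+ 2.
  by apply: sumr_ge0 => i _; exact: sqr_ge0.
have n0 : 0 < n%:R^-1 :> R by rewrite invr_gt0 ltr0n ltnW.
have t1 := mulr_ge0 (ltW n0) sum_ge0.
have t2 := mulr_ge0 (ltW lambda_gt0) (sqr_ge0 `|u.2|).
move=> le0.
have u2 : u.2 = 0.
  have : lambda * `|u.2| ^+ 2 = 0 by lra.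
  by move/eqP; rewrite mulf_eq0 gt_eqF//= sqrf_eq0 normr_eq0 => /eqP.
have : n%:R^-1 * \sum_(i < n) affine_plus u (z i) ^+ 2 = 0 by lra.
move/eqP; rewrite mulf_eq0 gt_eqF//= psumr_eq0; last by move=> i _; exact: sqr_ge0.
move=> /allP line.
have lineE i : u.1.1 + u.1.2 * z i = 0.
  have := line i (mem_index_enum _); rewrite sqrf_eq0 /affine_plus u2.
  by rewrite linear0 addr0 => /eqP.
have n_gt0 := ltnW n_gt1.
pose i0 := Ordinal n_gt0; pose i1 := Ordinal n_gt1.
have z01 : z i1 - z i0 != 0.
  by rewrite subr_eq0; apply/eqP => /z_inj/(congr1 val).
have u12 : u.1.2 = 0.
  apply: (mulIf z01); rewrite mul0r mulrBr.
  by have := lineE i0; have := lineE i1; lra.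
have u11 : u.1.1 = 0 by have := lineE i0; rewrite u12 mul0r addr0.
apply/eqP; rewrite -subr_eq0; apply/eqP; rewrite -/u.
by move: u11 u12 u2; case: (u) => [[? ?] ?] /= -> -> ->.
Qed.

End Smoothing.

(** * The time-integrated energy *)

Section TimeDependentEnergy.
Context {R : realType} {K : R -> R -> R} (H : rkhs K).
Hypothesis affine_inj : injective (@affine_plus R K H).
Hypothesis cev : continuous (fun q : R * H => rkhs_fun H q.2 q.1).
Variables (n : nat) (x y : 'I_n -> R) (lambda : R).
Hypothesis lambda_ge0 : 0 <= lambda.

Notation coords := (R * R * H)%type.
Notation mu := (@lebesgue_measure R).

Lemma affine_plus_continuous :
  continuous (fun s : R * coords => affine_plus s.2 s.1).
Proof.
move=> s; rewrite /affine_plus.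
have c1 : continuous (fun s : R * coords => s.1) by move=> ?; exact: cvg_fst.
have c2 : continuous (fun s : R * coords => s.2) by move=> ?; exact: cvg_snd.
have c21 : continuous (fun s : R * coords => s.2.1).
  by move=> u; apply: (continuous_comp (c2 u)); exact: cvg_fst.
have c22 : continuous (fun s : R * coords => s.2.2).
  by move=> u; apply: (continuous_comp (c2 u)); exact: cvg_snd.
apply: cvgD; last exact: (continuous_pair_comp cev c1 c22).
apply: cvgD; first by apply: (continuous_comp (c21 s)); exact: cvg_fst.
apply: cvgM; last exact: c1.
by apply: (continuous_comp (c21 s)); exact: cvg_snd.
Qed.

Lemma path_point_continuous i : continuous (fun t : R => path_point x y t i).
Proof.
move=> t; rewrite /path_point; apply: cvgD; apply: cvgMl; first exact: cvg_id.
by apply: cvgB; [exact: cvg_cst|exact: cvg_id].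
Qed.

Lemma energy_at_affine_plus (t : R) (p : coords) :
  energy_at H x y lambda t (affine_plus p) =
  smoothing_energy lambda (path_point x y t) (fun i => y i - x i) p.
Proof. by rewrite /energy_at /rkhs_part decompK. Qed.

Lemma residual_ge0 (t : R) (f : R -> R) : 0 <= residual x y t f.
Proof.
rewrite /residual mulr_ge0 ?invr_ge0//.
by apply: sumr_ge0 => i _; exact: sqr_ge0.
Qed.

Lemma energy_at_ge0 (t : R) (f : R -> R) : 0 <= energy_at H x y lambda t f.
Proof. by rewrite addr_ge0 ?residual_ge0// mulr_ge0 ?sqr_ge0. Qed.

Lemma measurable_along_eq (w : R -> R -> R) (F : R * coords -> R) (g : R -> R) :
  vector_fields H w -> continuous F ->
  (forall t : R, t \in `[0, 1] -> g t = F (t, decomp H (w t))) ->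
  measurable_fun (`[0, 1] : set (measurableTypeR R))
    (g : measurableTypeR R -> measurableTypeR R).
Proof.
move=> vw cF gE; apply: eq_measurable_fun (measurable_along affine_inj vw cF) => t.
by rewrite inE => t01; rewrite -gE.
Qed.

Lemma measurable_residual (w : R -> R -> R) : vector_fields H w ->
  measurable_fun (`[0, 1] : set (measurableTypeR R))
    (fun t => residual x y t (w t) : measurableTypeR R).
Proof.
move=> vw.
(* At times in [[0, 1]] the field is recovered from its coordinates, so [F] gives the residual
   there. *)
pose F (s : R * coords) := residual x y s.1 (affine_plus s.2).
apply: (@measurable_along_eq w F) => // [s|t t01]; last first.
  by rewrite /F /= Htilde_decomp//; exact: vw.1.
rewrite /F /residual; apply: cvgMr.
apply: (@continuous_bigsum _ _ _ _ _ R) => i _.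
have cres : continuous (fun s : R * coords =>
    y i - x i - affine_plus s.2 (path_point x y s.1 i)).
  move=> u'; apply: cvgB; first exact: cvg_cst.
  apply: (continuous_pair_comp affine_plus_continuous
    (f := fun s : R * coords => path_point x y s.1 i) (g := snd)) => s'.
    apply: (@continuous_comp _ _ _ fst (fun t => path_point x y t i)).
      exact: cvg_fst.
    exact: path_point_continuous.
  exact: cvg_snd.
move=> u; exact: (continuous_comp (cres u) (@exprn_continuous R 2 _)).
Qed.

Lemma measurable_rkhs_norm (w : R -> R -> R) : vector_fields H w ->
  measurable_fun (`[0, 1] : set (measurableTypeR R))
    (fun t => `|rkhs_part H (w t)| ^+ 2 : measurableTypeR R).
Proof.
move=> vw; pose F (s : R * coords) := `|s.2.2| ^+ 2.
apply: (@measurable_along_eq w F) => // s; rewrite /F.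
have c22 : continuous (fun s : R * coords => `|s.2.2|).
  move=> u; apply: cvg_norm.
  by apply: (@continuous_comp _ _ _ snd snd); exact: cvg_snd.
exact: (continuous_comp (c22 s) (@exprn_continuous R 2 _)).
Qed.

Lemma measurable_energy_at (w : R -> R -> R) : vector_fields H w ->
  measurable_fun (`[0, 1] : set (measurableTypeR R))
    (fun t => energy_at H x y lambda t (w t) : measurableTypeR R).
Proof.
move=> vw; apply: measurable_funD; first exact: measurable_residual.
by apply: measurable_funM; [exact: measurable_cst|exact: measurable_rkhs_norm].
Qed.

(** Both integrands are nonnegative and measurable, so the integrals add up even when infinite;
    energies can then be compared time by time. *)
Lemma energyE (w : R -> R -> R) : vector_fields H w ->
  energy H x y lambda w =
  (\int[mu]_(t in `[0%R, 1%R]) (energy_at H x y lambda t (w t))%:E)%E.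
Proof.
move=> vw; rewrite /energy -ge0_integralZl//; last first.
  by apply/measurable_EFinP; exact: measurable_rkhs_norm.
rewrite -ge0_integralD//.
- by move=> t _; rewrite lee_fin residual_ge0.
- by apply/measurable_EFinP; exact: measurable_residual.
- by move=> t _; rewrite -EFinM lee_fin mulr_ge0 ?sqr_ge0.
- by apply: measurable_funeM; by apply/measurable_EFinP; exact: measurable_rkhs_norm.
Qed.

Lemma energy_minimizer (v : R -> R -> R) :
  vector_fields H v ->
  (forall t : R, t \in `[0, 1] ->
    minimizes (Htilde H) (energy_at H x y lambda t) (v t)) ->
  minimizes (vector_fields H) (energy H x y lambda) v.
Proof.
move=> vv vmin; split => // w vw; rewrite !energyE//.
apply: ge0_le_integral => //.
- by move=> t _; rewrite lee_fin energy_at_ge0.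
- by apply/measurable_EFinP; exact: measurable_energy_at.
- by apply/measurable_EFinP; exact: measurable_energy_at.
- by move=> t t01; rewrite lee_fin; apply: (vmin t t01).2; exact: vw.1.
Qed.

(** The energy of [w] exceeds that of [v] at each time, yet the integrals agree, so the excess is 0
    almost everywhere. At such times [w t] also minimizes, hence is [v t]. *)
Lemma energy_minimizer_unique (v w : R -> R -> R) (B : R) :
  vector_fields H v ->
  (forall t : R, t \in `[0, 1] -> energy_at H x y lambda t (v t) <= B) ->
  (forall t : R, t \in `[0, 1] ->
    minimizes (Htilde H) (energy_at H x y lambda t) (v t) /\
    forall f, minimizes (Htilde H) (energy_at H x y lambda t) f -> f = v t) ->
  minimizes (vector_fields H) (energy H x y lambda) w ->
  {ae mu, forall t : R, t \in `[0, 1] -> w t = v t}.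
Proof.
move=> vv vB vmin [vw wmin].
set I := (`[0, 1]%classic : set (measurableTypeR R)).
have mI : measurable I by exact: measurable_itv.
pose f t := energy_at H x y lambda t (w t).
pose g t := energy_at H x y lambda t (v t).
have mf := measurable_energy_at vw; have mg := measurable_energy_at vv.
have gf t : I t -> g t <= f t by move=> t01; apply: (vmin t t01).1.2; exact: vw.1.
(* Finiteness, due to the bound [B], is what allows the two integrals to be subtracted. *)
have ig_lt : (\int[mu]_(t in I) (g t)%:E < +oo)%E.
  apply: (@le_lt_trans _ _ (\int[mu]_(t in I) B%:E)%E).
    apply: ge0_le_integral => //.
    - by move=> t _; rewrite lee_fin energy_at_ge0.
    - by apply/measurable_EFinP.
  rewrite integral_cst// [X in (_ * X)%E](_ : _ = 1%E); last first.
    by apply: (etrans (lebesgue_measure_itv `[0, 1])); rewrite /= lte_fin ltr01 sube0.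
  by rewrite mule1 ltry.
have fg_le : (\int[mu]_(t in I) (f t)%:E <= \int[mu]_(t in I) (g t)%:E)%E.
  by have := wmin v vv; rewrite !energyE.
have int_of (h : R -> R) : (forall t, 0 <= h t) ->
    measurable_fun I (h : measurableTypeR R -> measurableTypeR R) ->
    (\int[mu]_(t in I) (h t)%:E < +oo)%E ->
    mu.-integrable I (EFin \o h).
  move=> h0 mh ih; apply/integrableP; split; first exact/measurable_EFinP.
  by under eq_integral do rewrite /= ger0_norm//.
have If := int_of f (fun t => energy_at_ge0 t _) mf (le_lt_trans fg_le ig_lt).
have Ig := int_of g (fun t => energy_at_ge0 t _) mg ig_lt.
have diff0 : (\int[mu]_(t in I) `|(f t)%:E - (g t)%:E| = 0)%E.
  transitivity (\int[mu]_(t in I) ((f t)%:E - (g t)%:E))%E.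
    apply: eq_integral => t; rewrite inE => t01.
    rewrite gee0_abs// -EFinB lee_fin subr_ge0.
    exact: gf.
  rewrite integralB//; apply/eqP; rewrite eq_le; apply/andP; split.
    by rewrite sube_le0; apply: fg_le.
  rewrite sube_ge0; last by rewrite (integrable_fin_num mI Ig).
  apply: ge0_le_integral => //.
  - by move=> t _; rewrite lee_fin energy_at_ge0.
  - by apply/measurable_EFinP.
  - by apply/measurable_EFinP.
have mfg := measurable_int _ (integrableB mI If Ig).
have [/(_ diff0) ae_fg _] := ae_eq_integral_abs mu mI mfg.
apply: filterS ae_fg => t ae_t t01.
have /eqP := ae_t t01; rewrite /= -EFinB eqe subr_eq0 => /eqP fgt.
apply: (vmin t t01).2; split; first exact: vw.1.
by move=> q Hq; rewrite -/(f t) fgt; apply: (vmin t t01).1.2.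
Qed.

End TimeDependentEnergy.

Lemma affine_plus_inj {R : realType} {K : R -> R -> R} (H : rkhs K) (M : R) :
  (forall z, K z z <= M) ->
  (forall h : H, (rkhs_fun H h : R -> R) \in Lfun lebesgue_measure 2%:E) ->
  injective (@affine_plus R K H).
Proof.
move=> KM HL2 p q pq.
have pq0 u : affine_plus (p - q) u = 0 by rewrite -affine_plusB pq /= subrr.
have [e1 e2 e3] := affine_rkhs_eq0 KM (HL2 (p - q).2) pq0.
apply/eqP; rewrite -subr_eq0; apply/eqP.
by move: e1 e2 e3; case: (p - q) => [[? ?] ?] /= -> -> ->.
Qed.

(** * Clamping of time to the unit interval *)

Section Clamp.
Context {R : realType}.

Definition clamp01 (t : R) : R := Num.max 0 (Num.min t 1).

Lemma clamp01_itv (t : R) : 0 <= clamp01 t <= 1.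
Proof. by rewrite /clamp01 le_max lexx ge_max ler01 ge_min lexx orbT. Qed.

Lemma clamp01_id (t : R) : t \in `[0, 1] -> clamp01 t = t.
Proof.
by rewrite in_itv/= => /andP[t0 t1]; rewrite /clamp01 (min_idPl t1) (max_idPr t0).
Qed.

Lemma clamp01_continuous : continuous clamp01.
Proof.
move=> t.
have cmin : {for t, continuous ((@id R : R -> R^o) \min (cst 1 : R -> R^o))}.
  by apply: continuous_min; [exact: cvg_id|exact: cvg_cst].
have c0 : {for t, continuous (cst 0 : R -> R^o)} by exact: cvg_cst.
exact: (continuous_max c0 cmin).
Qed.

Lemma clamp01_bounded (f : R -> R) : continuous f ->
  exists B, forall t, f (clamp01 t) <= B.
Proof.
move=> cf; have [c _ hc] := @EVT_max R f 0 1 ler01 (continuous_subspaceT cf).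
by exists (f c) => t; apply: hc; rewrite in_itv/= clamp01_itv.
Qed.

End Clamp.

(** * The minimizing vector field and its flow *)

Theorem proposition4p1 (R : realType) (K : R -> R -> R)
  (K_pd : positive_definite_kernel K)
  (H : rkhs K)
  (H_L2 : forall h : H, (rkhs_fun H h : R -> R) \in Lfun lebesgue_measure 2%:E)
  (K_bounded : exists M : R, forall x y : R, `|K x y| <= M)
  (K_continuous : continuous (fun z : R * R => K z.1 z.2))
  (C1 : R)
  (H_lipschitz : forall (h : H) (x y : R),
     `|rkhs_fun H h x - rkhs_fun H h y| <= C1 * `|h| * `|x - y|)
  (n : nat) (n_gt2 : (2 < n)%N)
  (lambda : R) (lambda_gt0 : 0 < lambda)
  (x y : 'I_n -> R)
  (x_itv : forall i, 0 <= x i <= 1)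
  (path_distinct : forall t : R, 0 <= t <= 1 -> injective (path_point x y t)) :
  exists v : R -> R -> R,
    [/\ minimizes (vector_fields H) (energy H x y lambda) v,
        forall w, minimizes (vector_fields H) (energy H x y lambda) w ->
          {ae lebesgue_measure, forall t : R, t \in `[0, 1] -> w t = v t},
        forall t : R, t \in `[0, 1] ->
          minimizes (Htilde H) (energy_at H x y lambda t) (v t) /\
          (forall f, minimizes (Htilde H) (energy_at H x y lambda t) f ->
             f = v t),
        vector_fields2 H v &
        exists phi : R -> R -> R,
          [/\ flow_from_identity v phi,
              forall psi, flow_from_identity v psi ->
                forall t s : R, t \in `[0, 1] -> s \in `[0, 1] -> psi t s = phi t s &
              {in `[0, 1] &, {homo phi 1 : s1 s2 / s1 < s2}}]].
Proof.
have [M KM'] := K_bounded.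
have KM u : K u u <= M by exact: le_trans (ler_norm _) (KM' u u).
have affine_inj := affine_plus_inj KM H_L2.
have cev := rkhs_eval_continuous KM H_lipschitz.
have csec := rkhs_section_continuous (H := H) K_continuous.
have n_gt1 : (1 < n)%N by exact: ltnW.
(* Freezing time outside [0, 1] makes every function continuous on the line. *)
pose z (t : R) i := path_point x y (clamp01 t) i.
have cz i : continuous (fun t : R => z t i : R).
  exact: (continuous_compT clamp01_continuous (@path_point_continuous R n x y i)).
have z_inj t : injective (z t) by apply: path_distinct; exact: clamp01_itv.
have c_ge0 : 0 <= (n%:R * lambda)^-1 by rewrite invr_ge0 mulr_ge0// ltW.
have [r [a [b [[cr ca cb] kkt]]]] :=
  kkt_solution K_pd K_continuous n_gt1 c_ge0 (fun i => y i - x i) cz z_inj.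
pose p0 t : R * R * H := ((a t, b t), kernel_combination H lambda (z t) (r t)).
have ch : continuous (fun t => kernel_combination H lambda (z t) (r t)).
  apply: continuous_bigsum => i _ t.
  apply: cvgZ; last exact: (continuous_compT (cz i) csec).
  by apply: cvgMr; exact: cr.
have cp0 : continuous p0.
  by move=> t; exact: (cvg_pair (cvg_pair (ca t) (cb t)) (ch t)).
(* [r], [a] and [b] come from an existence statement and need not be constant outside [[0, 1]].
   Clamping again confines [p] to the values of [p0] on a compact interval, so one Lipschitz
   constant holds at all real times. *)
pose p t := p0 (clamp01 t).
have cp : continuous p by exact: (continuous_compT clamp01_continuous cp0).
pose v t := affine_plus (p t).
have zE t : t \in `[0, 1] -> z t = path_point x y t.
  by move=> t01; rewrite /z clamp01_id.
have energy_vE t : t \in `[0, 1] -> energy_at H x y lambda t (v t) =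
    smoothing_energy lambda (z t) (fun i => y i - x i) (p0 t).
  by move=> t01; rewrite /v energy_at_affine_plus// zE// /p clamp01_id.
have vmin t : t \in `[0, 1] ->
    minimizes (Htilde H) (energy_at H x y lambda t) (v t) /\
    forall f, minimizes (Htilde H) (energy_at H x y lambda t) f -> f = v t.
  move=> t01; have [k1 k2 k3] := kkt t.
  have vle (q : R * R * H) : energy_at H x y lambda t (v t) <=
      energy_at H x y lambda t (affine_plus q).
    by rewrite energy_vE// energy_at_affine_plus// -zE//; exact: smoothing_energy_min.
  split; first by split => [|_ [q _ <-]] //; exists (p t).
  move=> _ [[q _ <-] /(_ (v t)) qmin].
  rewrite /v /p clamp01_id//; congr affine_plus.
  apply: (smoothing_energy_unique n_gt1 lambda_gt0 k1 k2 k3 (z_inj t)).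
  rewrite -energy_vE// zE// -energy_at_affine_plus//.
  by apply: qmin; exists (p t).
have vv : vector_fields H v by exact: vector_fields_affine_plus.
have cv : continuous (fun q : R * R => v q.1 q.2).
  apply: (continuous_pair_comp (affine_plus_continuous cev)
    (f := snd) (g := fun q : R * R => p q.1)) => q; first exact: cvg_snd.
  by apply: (continuous_compT (f := fst) (g := p)) => // ?; exact: cvg_fst.
have [L L_gt0 lipv] : exists2 L, 0 < L &
    forall t u w, `|v t u - v t w| <= L * `|u - w|.
  have cp01 : continuous (fun t => `|(p0 t).1.2| + `|C1| * `|(p0 t).2|).
    move=> t; apply: cvgD; first by apply: cvg_norm; exact: cb.
    apply: cvgMr; apply: cvg_norm.
    by apply: (continuous_compT (g := snd) cp0) => ?; exact: cvg_snd.
  have [B hB] := clamp01_bounded cp01.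
  (* The maximum with 1 provides the positive constant required by the Picard iteration. *)
  exists (Num.max 1 B); first by rewrite lt_max ltr01.
  move=> t u w; apply: (@le_trans _ _ (B * `|u - w|)); last first.
    by rewrite ler_wpM2r// le_max lexx orbT.
  apply: (le_trans _ (ler_wpM2r (normr_ge0 _) (hB t))).
  rewrite /v /affine_plus.
  rewrite (_ : _ - _ = (p t).1.2 * (u - w) +
    (rkhs_fun H (p t).2 u - rkhs_fun H (p t).2 w)); last by ring.
  apply: le_trans (ler_normD _ _) _; rewrite mulrDl normrM lerD2l.
  apply: le_trans (H_lipschitz _ _ _) _.
  by rewrite !ler_wpM2r// ler_norm.
have [sol solP] : {sol : R -> R -> R & forall s, trajectory v s (sol s)}.
  exact: (choice (fun s => trajectory_exists s cv L_gt0 lipv)).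
exists v; split => //.
- by apply: energy_minimizer => // [|t t01]; [exact: ltW|exact: (vmin t t01).1].
(* The bound [B] is the energy of the zero field, which does not depend on time. *)
- move=> w; apply: (energy_minimizer_unique affine_inj cev (ltW lambda_gt0)
    (B := n%:R^-1 * \sum_(i < n) (y i - x i) ^+ 2)) => // t t01.
  apply: le_trans ((vmin t t01).1.2 (affine_plus (0 : R * R * H)) _) _.
    by exists 0.
  rewrite energy_at_affine_plus// /smoothing_energy /= normr0 expr0n mulr0 addr0.
  rewrite le_eqVlt; apply/orP; left; apply/eqP; congr (_ * _).
  apply: eq_bigr => i _; rewrite /affine_plus /= linear0 mul0r !addr0.
  by rewrite subr0.
- split => //.
  (* The norm of a continuous curve of coordinates is continuous, so its square has a finite
     integral on [[0, 1]]. *)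
  have csum : continuous (fun t => `|(p t).1| + `|(p t).2|).
    move=> t; apply: cvgD; apply: cvg_norm.
      by apply: (continuous_compT (g := fst) cp) => ?; exact: cvg_fst.
    by apply: (continuous_compT (g := snd) cp) => ?; exact: cvg_snd.
  have cnorm : continuous (fun t => (Htilde_norm H (v t)) ^+ 2).
    rewrite (_ : (fun t => _) = (fun t => (`|(p t).1| + `|(p t).2|) ^+ 2)).
      exact: (continuous_compT csum (@exprn_continuous R 2)).
    by apply/funext => t; rewrite /v Htilde_norm_affine_plus.
  exact: integrable_lty (continuous_within_integrable (continuous_subspaceT cnorm)).
- exists (fun t s => sol s t); split.
  + by move=> s _; exact: solP.
  + move=> psi flow_psi t s t01 s01.
    exact: (trajectory_unique cv lipv (solP s) (flow_psi s s01) t01).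
  + by move=> s1 s2 _ _; exact: (trajectory_increasing cv lipv (solP s1) (solP s2)).
Qed.
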